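(* Let $r\in(0,\infty)$ and let $f\in C^1[0,r)$ satisfy (i) $f(u)>0$ for $0\le u<r$; (ii) $f'(u)>0$ for $0<u<r$; (iii) $0<\liminf_{u\to r^-}(r-u)f(u)\le\infty$. For $\lambda>0$ consider the problem $$u''''(x)=\lambda f(u(x)),\quad x\in(0,1),\qquad u(0)=u(1)=u'(0)=u'(1)=0. \qquad (P_\lambda)$$ (a) If $I\subset[0,\infty)$ is a bounded interval, then there exists a positive constant $C$ such that any positive solution $u_\lambda$ of $(P_\lambda)$ with $\lambda\in I$ satisfies $$\|u_\lambda\|_{C^3[0,1]}\le C.$$ (b) If further $I\subset(0,\infty)$ is a compact interval, then there exist two positive constants $c$ and $C_1$ such that any positive solution $u_\lambda$ of $(P_\lambda)$ with $\lambda\in I$ satisfies $$\|u_\lambda\|_{C[0,1]}\le c<r\quad\text{and}\quad \|u_\lambda\|_{C^4[0,1]}\le C_1.$$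
   Context: A positive solution of $(P_\lambda)$ (with $\lambda>0$) is a function $u\in C^4[0,1]$ satisfying $(P_\lambda)$ with $u\ge 0$ and $u\not\equiv 0$ on $(0,1)$; since $f$ is defined on $[0,r)$, its values lie in $[0,r)$. The norms $\|\cdot\|_{C^k[0,1]}$ are the usual ones, and $C[0,1]$ carries the supremum norm. *)

(* Defs.v *)
From mathcomp Require Import all_boot all_order all_algebra.
From mathcomp Require Import all_classical all_reals all_analysis.
Import Order.TTheory GRing.Theory Num.Theory numFieldNormedType.Exports.

Set Implicit Arguments.
Unset Strict Implicit.
Unset Printing Implicit Defensive.

Local Open Scope classical_set_scope.
Local Open Scope ring_scope.

Section CkOn.
Context {R : realType}.
Implicit Types (D : set R) (g : R -> R) (x : R).

(* Derivatives relative to a set D: the difference quotient is taken along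
   points of D only, so that the derivative is one-sided at an endpoint of an
   interval and the values of g outside D are irrelevant. *)
Definition diff_quot g x : R -> R := fun y => (g y - g x) / (y - x).

Definition derivable_in D g x := cvg (diff_quot g x @ within D x^').

Definition derive_in D g x : R := lim (diff_quot g x @ within D x^').

Definition derive_in_n D k g : R -> R := iter k (derive_in D) g.

Definition Ck_on D k g :=
  (forall i x, (i < k)%N -> D x -> derivable_in D (derive_in_n D i g) x) /\
  {within D, continuous (derive_in_n D k g)}.

(* The supremum in R is 0 by convention for a set that is not bounded above;
   this does not occur for g in C^k(D) with D compact. *)
Definition C_norm D g : R := sup [set `|g x| | x in D].

Definition Ck_norm D k g : R := \sum_(i < k.+1) C_norm D (derive_in_n D i g).

Lemma diff_quot_filterE D g x : nbhs x D ->
  diff_quot g x @ within D x^' = (fun h => h^-1 *: (g (h + x) - g x)) @ 0^'.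
Proof.
move=> xD; apply/predeqP => P; split => /=.
- move/nbhs_ballP: xD => [d /= d0 dD] /nbhs_ballP[e /= e0 eP].
  apply/nbhs_ballP; exists (Num.min d e) => /=; first by rewrite lt_min d0.
  move=> h; rewrite -ball_normE /= sub0r normrN lt_min => /andP[hd he] h0.
  rewrite [_ *: _]mulrC; have -> : h^-1 = (h + x - x)^-1 by rewrite addrK.
  apply: (eP (h + x)).
  + by rewrite -ball_normE /= opprD addrCA subrr addr0 normrN.
  + by rewrite -subr_eq0 addrK.
  + by apply: dD; rewrite -ball_normE /= opprD addrCA subrr addr0 normrN.
- move/nbhs_ballP => [e /= e0 eP]; apply/nbhs_ballP; exists e => //= y xy yx _.
  have /= := eP (y - x).
  rewrite subrK [_ *: _]mulrC; apply; last by rewrite subr_eq0.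
  by move: xy; rewrite -!ball_normE /= sub0r normrN distrC.
Qed.

Lemma derivable_inE D g x : nbhs x D -> derivable_in D g x <-> derivable g x 1.
Proof.
move=> xD; rewrite /derivable_in diff_quot_filterE// /derivable.
suff -> : (fun h : R => h^-1 *: (g (h + x) - g x)) =
  (fun h : R => h^-1 *: ((g \o shift x) (h *: (1 : R)) - g x)) by [].
by apply/funext => h /=; rewrite [h *: _]mulr1.
Qed.

Lemma derive_inE D g x : nbhs x D -> derive_in D g x = derive1 g x.
Proof. by move=> xD; rewrite /derive_in diff_quot_filterE. Qed.

Definition positive_solution (r : R) (f : R -> R) (lambda : R) (u : R -> R) :=
  let D : set R := `[0, 1]%classic in
  [/\ 0 < lambda,
      Ck_on D 4 u,
      [/\ forall x, x \in `[0, 1] -> 0 <= u x < r &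
          exists2 x, x \in `]0, 1[ & u x != 0],
      forall x, x \in `]0, 1[ -> derive_in_n D 4 u x = lambda * f (u x) &
      [/\ u 0 = 0, u 1 = 0, derive_in D u 0 = 0 & derive_in D u 1 = 0]].

End CkOn.

(* Main.v *)
(* Since 0 <= u < r, the iterated mean value theorem bounds |u'''| at some point
   of every subinterval, hence on [d, 1 - d] for each d > 0, as u''' increases.
   This gives a lower bound u'' >= - K on all of [0, 1], so the maximum point m
   satisfies u(m) <= K (1 - m) and u(m) <= K m.  If u(m) < r / 2 then
   u'''' <= lambda f(r / 2); otherwise m stays away from 0 and 1, and u''' is
   convex on [0, m] and concave on [m, 1], so that its interior bounds
   extrapolate to the endpoints.  For the second part, if r - u(m) <= s^2 then
   r - u <= (1 + K) s^2 within s of m, where (iii) makes u'''' at least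
   lambda k / ((1 + K) s^2); its integral over a length s, of order 1 / s,
   would exceed the bound on the variation of u''' for small s. *)

Require Import Defs.
From mathcomp Require Import all_boot all_order all_algebra.
From mathcomp Require Import all_classical all_reals all_analysis.
From mathcomp Require Import ring lra.
Import Order.TTheory GRing.Theory Num.Theory numFieldNormedType.Exports.

Set Implicit Arguments.
Unset Strict Implicit.
Unset Printing Implicit Defensive.

Local Open Scope classical_set_scope.
Local Open Scope ring_scope.

(** * Mean value estimates on [0, 1] *)

Section MeanValue.
Context {R : realType}.
Implicit Types (g dg : R -> R) (a b k l x : R).

Definition mean_value g dg := forall a b, 0 <= a -> a < b -> b <= 1 ->
  exists2 c, a < c < b & g b - g a = dg c * (b - a).

Lemma mean_value_reflect g dg : mean_value g dg ->
  mean_value (fun x => g (1 - x)) (fun x => - dg (1 - x)).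
Proof.
move=> mv a b a0 ab b1; have [||| c /andP[ac cb] e] := mv (1 - b) (1 - a).
1-3: lra.
exists (1 - c); first by apply/andP; split; lra.
rewrite (_ : 1 - (1 - c) = c); last by ring.
by rewrite -opprB e; ring.
Qed.

(** Reflection flips the sign of derivatives of odd order; in this variant the sign already sits on
    [g] and cancels in the next derivative. *)
Lemma mean_value_reflectN g dg : mean_value g dg ->
  mean_value (fun x => - g (1 - x)) (fun x => dg (1 - x)).
Proof.
move=> mv a b a0 ab b1; have [||| c /andP[ac cb] e] := mv (1 - b) (1 - a).
1-3: lra.
exists (1 - c); first by apply/andP; split; lra.
rewrite (_ : 1 - (1 - c) = c); last by ring.
by rewrite opprK addrC e; ring.
Qed.

Lemma mean_value_le g dg a b k : mean_value g dg ->
    0 <= a -> a <= b -> b <= 1 -> (forall x, a < x < b -> dg x <= k) ->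
  g b - g a <= k * (b - a).
Proof.
move=> mv a0; rewrite le_eqVlt => /orP[/eqP-> _ _|ab b1 H].
  by rewrite !subrr mulr0.
have [c /H cab ->] := mv _ _ a0 ab b1.
by apply: ler_wpM2r => //; lra.
Qed.

Lemma mean_value_ge g dg a b k : mean_value g dg ->
    0 <= a -> a <= b -> b <= 1 -> (forall x, a < x < b -> k <= dg x) ->
  k * (b - a) <= g b - g a.
Proof.
move=> mv a0; rewrite le_eqVlt => /orP[/eqP-> _ _|ab b1 H].
  by rewrite !subrr mulr0.
have [c /H cab ->] := mv _ _ a0 ab b1.
by apply: ler_wpM2r => //; lra.
Qed.

Lemma mean_value_norm g dg a b k : mean_value g dg ->
    0 <= a <= 1 -> 0 <= b <= 1 -> (forall x, 0 <= x <= 1 -> `|dg x| <= k) ->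
  `|g b - g a| <= k.
Proof.
move=> mv; wlog ab : a b / a <= b => [hwlog a01 b01 dgk|].
  by have [/hwlog|/ltW/hwlog] := leP a b; [|rewrite distrC]; apply.
move=> /andP[a0 _] /andP[_ b1] dgk; have k0 : 0 <= k.
  by apply: le_trans (normr_ge0 (dg a)) (dgk _ _); apply/andP; lra.
have kab : k * (b - a) <= k by rewrite ler_piMr//; lra.
rewrite ler_norml; apply/andP; split.
  apply: (@le_trans _ _ (- k * (b - a))); first by rewrite mulNr lerN2.
  apply: (mean_value_ge mv a0 ab b1) => x /andP[? ?].
  have : `|dg x| <= k by apply: dgk; apply/andP; lra.
  by rewrite ler_norml => /andP[].
apply: le_trans kab; apply: (mean_value_le mv a0 ab b1) => x /andP[? ?].
have : `|dg x| <= k by apply: dgk; apply/andP; lra.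
by rewrite ler_norml => /andP[].
Qed.

Definition somewhere_bounded g (B : R -> R) := forall a l,
  0 <= a -> 0 < l -> a + l <= 1 -> exists2 c, a < c < a + l & `|g c| <= B l.

(** Pick a point with small [g] in each outer third: the two are at least [l / 3] apart, and the
    slope between them is a value of [dg]. *)
Lemma somewhere_bounded_deriv g dg B : mean_value g dg ->
  somewhere_bounded g B ->
  somewhere_bounded dg (fun l => 2 * B (l / 3) / (l / 3)).
Proof.
move=> mv gB a l a0 l0 al1.
have [||| p /andP[p1 p2] gp] := gB a (l / 3); [lra..|].
have [||| q /andP[q1 q2] gq] := gB (a + l / 3 + l / 3) (l / 3); [lra..|].
have [||| c /andP[c1 c2] e] := mv p q; [lra..|].
exists c; first by apply/andP; split; lra.
have l3 : 0 < l / 3 by lra.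
rewrite ler_pdivlMr//.
have : `|dg c * (q - p)| <= 2 * B (l / 3).
  rewrite -e; move: gp gq; rewrite !ler_norml => /andP[? ?] /andP[? ?].
  by apply/andP; split; lra.
apply: le_trans; rewrite normrM; apply: ler_wpM2l => //.
by rewrite ger0_norm; lra.
Qed.

End MeanValue.

(** * The clamped beam and its reflection *)

Section Beam.
Context {R : realType}.
Implicit Types r lambda m x y v C K : R.

(* Of the differentiability of u only the mean value property between
   consecutive derivatives is kept: it passes at once to x |-> u (1 - x). *)
Record beam r f lambda u0 u1 u2 u3 u4 m : Prop := Beam {
  beam_mv0 : mean_value u0 u1;
  beam_mv1 : mean_value u1 u2;
  beam_mv2 : mean_value u2 u3;
  beam_mv3 : mean_value u3 u4;
  beam_eq : forall x, 0 < x < 1 -> u4 x = lambda * f (u0 x);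
  beam_range : forall x, 0 <= x <= 1 -> 0 <= u0 x < r;
  beam_u00 : u0 0 = 0;
  beam_u01 : u0 1 = 0;
  beam_u10 : u1 0 = 0;
  beam_u11 : u1 1 = 0;
  beam_m : 0 < m < 1;
  beam_crit : u1 m = 0;
  beam_max : forall x, 0 <= x <= 1 -> u0 x <= u0 m }.
Arguments beam_mv0 {r f lambda u0 u1 u2 u3 u4 m} _.
Arguments beam_mv1 {r f lambda u0 u1 u2 u3 u4 m} _.
Arguments beam_mv2 {r f lambda u0 u1 u2 u3 u4 m} _.
Arguments beam_mv3 {r f lambda u0 u1 u2 u3 u4 m} _.

(** Several estimates below treat one side of the peak only; this symmetry transfers them to the
    other side. *)
Lemma beam_reflect r f lambda u0 u1 u2 u3 u4 m :
  beam r f lambda u0 u1 u2 u3 u4 m ->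
  beam r f lambda (fun x => u0 (1 - x)) (fun x => - u1 (1 - x))
    (fun x => u2 (1 - x)) (fun x => - u3 (1 - x)) (fun x => u4 (1 - x)) (1 - m).
Proof.
case=> mv0 mv1 mv2 mv3 e rg u00 u01 u10 u11 /andP[m0 m1] um umax.
have i1 x : 0 <= x <= 1 -> 0 <= 1 - x <= 1 by move=> /andP[? ?]; apply/andP; lra.
have i2 x : 0 < x < 1 -> 0 < 1 - x < 1 by move=> /andP[? ?]; apply/andP; lra.
have mm : 1 - (1 - m) = m by ring.
split; rewrite ?subr0 ?subrr ?mm ?u10 ?u11 ?um ?oppr0 //.
- exact: mean_value_reflect.
- exact: mean_value_reflectN.
- exact: mean_value_reflect.
- exact: mean_value_reflectN.
- by move=> x /i2/e.
- by move=> x /i1/rg.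
- by apply/andP; lra.
- by move=> x /i1/umax.
Qed.

(** * A priori estimates, uniform over solutions *)

Section Apriori.
Context (r : R) (f : R -> R).
Context (r_gt0 : 0 < r).
Context (f_gt0 : forall v : R, 0 <= v < r -> 0 < f v).
Context (f_nd : forall v w : R, 0 <= v -> v <= w -> w < r -> f v <= f w).

(* Every subinterval of length l has a point where |u^(k)| <= Bk l. *)
Let B1 (l : R) := 2 * r / (l / 3).
Let B2 (l : R) := 2 * B1 (l / 3) / (l / 3).
Let B3 (l : R) := 2 * B2 (l / 3) / (l / 3).

Let C1 := B2 (1 / 2) + B3 (1 / 4).

Let B3_ge0 (l : R) : 0 < l -> 0 <= B3 l.
Proof.
move=> l0; rewrite /B3 /B2 /B1.
by do ?[apply: divr_ge0|apply: mulr_ge0]; rewrite ?(ltW r_gt0) ?(ltW l0).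
Qed.

Let C1_ge0 : 0 <= C1.
Proof.
apply: addr_ge0; last by apply: B3_ge0; lra.
by rewrite /B2 /B1; do ?[apply: divr_ge0|apply: mulr_ge0]; rewrite ?(ltW r_gt0).
Qed.

Section Solution.
Context (lambda : R) (u0 u1 u2 u3 u4 : R -> R) (m : R).
Context (lambda_gt0 : 0 < lambda) (U : beam r f lambda u0 u1 u2 u3 u4 m).

Lemma beam_u4_gt0 x : 0 < x < 1 -> 0 < u4 x.
Proof.
move=> x01; rewrite (beam_eq U)// mulr_gt0// f_gt0//.
by apply: (beam_range U); move: x01 => /andP[? ?]; apply/andP; lra.
Qed.

Lemma beam_u3_nd x y : 0 <= x -> x <= y -> y <= 1 -> u3 x <= u3 y.
Proof.
move=> x0 xy y1; rewrite -subr_ge0.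
have := @mean_value_ge _ _ _ _ _ 0 (beam_mv3 U) x0 xy y1.
rewrite mul0r; apply => z /andP[? ?]; apply/ltW/beam_u4_gt0; apply/andP; lra.
Qed.

Lemma beam_somewhere_bounded : somewhere_bounded u2 B2 /\ somewhere_bounded u3 B3.
Proof.
have b0 : somewhere_bounded u0 (fun=> r).
  move=> a l a0 l0 al; exists (a + l / 2); first by apply/andP; lra.
  have /andP[? ?] : 0 <= u0 (a + l / 2) < r.
    by apply: (beam_range U); apply/andP; lra.
  by rewrite ler_norml; apply/andP; lra.
have b1 := somewhere_bounded_deriv (beam_mv0 U) b0.
have b2 := somewhere_bounded_deriv (beam_mv1 U) b1.
by split=> //; apply: somewhere_bounded_deriv (beam_mv2 U) b2.
Qed.

(** The monotone [u3] is squeezed between its values at good points of the two end intervals of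
    length [d]. *)
Lemma beam_u3_interior d x : 0 < d -> d <= x <= 1 - d -> `|u3 x| <= B3 d.
Proof.
move=> d0 /andP[x0 x1]; have [_ b3] := beam_somewhere_bounded.
have [||| p /andP[p1 p2]] := b3 0 d; [lra..|].
have [||| q /andP[q1 q2]] := b3 (1 - d) d; [lra..|].
rewrite !ler_norml => /andP[? ?] /andP[? ?].
have : u3 p <= u3 x by apply: beam_u3_nd; lra.
have : u3 x <= u3 q by apply: beam_u3_nd; lra.
by move=> ? ?; apply/andP; lra.
Qed.

(** Start from a point [p] of the middle half where [u2] is controlled. Monotonicity keeps [u3]
    above [u3 (1 / 4)] to the right of [p] and below [u3 (3 / 4)] to the left, so neither direction
    lowers [u2] by more than [B3 (1 / 4)]. *)
Lemma beam_u2_ge x : 0 <= x <= 1 -> - C1 <= u2 x.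
Proof.
move=> /andP[x0 x1]; have [b2 _] := beam_somewhere_bounded.
have [||| p /andP[p1 p2]] := b2 (1 / 4) (1 / 2); [lra..|].
rewrite ler_norml => /andP[b _].
have B0 : 0 <= B3 (1 / 4).
  apply: le_trans (normr_ge0 (u3 p)) _.
  by apply: beam_u3_interior; [lra|apply/andP; lra].
have k1 : `|u3 (1 / 4)| <= B3 (1 / 4).
  by apply: beam_u3_interior; [lra|apply/andP; lra].
have k2 : `|u3 (3 / 4)| <= B3 (1 / 4).
  by apply: beam_u3_interior; [lra|apply/andP; lra].
move: k1 k2; rewrite !ler_norml => /andP[k1 _] /andP[_ k2].
have [px|xp] := leP p x.
  have := @mean_value_ge _ _ _ p x (- B3 (1 / 4)) (beam_mv2 U).
  have : B3 (1 / 4) * (x - p) <= B3 (1 / 4) by rewrite ler_piMr//; lra.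
  move=> k3 k4; have := k4 ltac:(lra) px x1; rewrite /C1 => k5.
  have : - B3 (1 / 4) * (x - p) <= u2 x - u2 p.
    apply: k5 => y /andP[y1 y2]; apply: le_trans k1 _.
    by apply: beam_u3_nd; lra.
  by rewrite mulNr; lra.
have := @mean_value_le _ _ _ x p (B3 (1 / 4)) (beam_mv2 U).
have : B3 (1 / 4) * (p - x) <= B3 (1 / 4) by rewrite ler_piMr//; lra.
move=> k3 k4; have := k4 x0 (ltW xp) ltac:(lra); rewrite /C1 => k5.
have : u2 p - u2 x <= B3 (1 / 4) * (p - x).
  apply: k5 => y /andP[y1 y2]; apply: le_trans _ k2.
  by apply: beam_u3_nd; lra.
by lra.
Qed.

(** A second-order Taylor bound at the critical point [m]. Two uses of the mean value theorem give
    it without the factor 1/2. *)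
Lemma beam_drop x K : (forall y, 0 <= y <= 1 -> - K <= u2 y) -> m <= x <= 1 ->
  u0 m - K * (x - m) ^+ 2 <= u0 x.
Proof.
move=> u2K /andP[]; rewrite le_eqVlt => /orP[/eqP<-|mx] x1.
  by rewrite subrr expr0n mulr0 subr0.
have /andP[m0 m1] := beam_m U.
(* By Rolle, [u2] vanishes between the critical points 0 and [m]. *)
have K0 : 0 <= K.
  have [||| c /andP[? ?]] := beam_mv1 U 0 m; [lra..|].
  rewrite (beam_crit U) (beam_u10 U) subrr subr0.
  move=> /esym/eqP; rewrite mulf_eq0 (gt_eqF m0) orbF => /eqP c0.
  by have := u2K c; rewrite c0 oppr_le0; apply; apply/andP; lra.
have u1ge y : m < y < x -> - (K * (x - m)) <= u1 y.
  move=> /andP[y1 y2].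
  have := @mean_value_ge _ _ _ m y (- K) (beam_mv1 U).
  rewrite (beam_crit U) subr0.
  move=> /(_ ltac:(lra) ltac:(lra) ltac:(lra)) H.
  have : - K * (y - m) <= u1 y.
    by apply: H => z /andP[? ?]; apply: u2K; apply/andP; lra.
  apply: le_trans; rewrite mulNr lerN2; apply: ler_wpM2l => //; lra.
have := @mean_value_ge _ _ _ m x _ (beam_mv0 U)
  ltac:(lra) ltac:(lra) x1 u1ge.
by rewrite mulNr -mulrA -expr2; lra.
Qed.

(** This is [beam_drop] at the clamped end 1; it keeps high peaks away from that end. *)
Lemma beam_peak_right : u0 m <= C1 * (1 - m).
Proof.
have /andP[m0 m1] := beam_m U.
have := @beam_drop 1 C1 beam_u2_ge.
rewrite (beam_u01 U) subr_le0 => H.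
apply: le_trans (H _) _; first by apply/andP; lra.
by apply: (ler_wpM2l C1_ge0); rewrite expr2 ler_piMr//; lra.
Qed.

(** A negative value of [u1] would force [u2] from negative at [q] to positive at [p], so [u3] is
    positive in between and, being nondecreasing, from there on. But Rolle on [[m], 1] makes [u2]
    vanish at some [y] beyond [p], so [u3] would be negative in between. *)
Lemma beam_u1_ge0 x : 0 <= x <= m -> 0 <= u1 x.
Proof.
move=> /andP[x0 xm]; have /andP[m0 m1] := beam_m U.
rewrite leNgt; apply/negP => u1x.
have x0' : 0 < x.
  rewrite lt_neqAle x0 andbT; apply/eqP => x0'.
  by move: u1x; rewrite -x0' (beam_u10 U) ltxx.
have xm' : x < m.
  rewrite lt_neqAle xm andbT; apply/eqP => x0''.
  by move: u1x; rewrite x0'' (beam_crit U) ltxx.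
have [||| q /andP[q0 qx]] := beam_mv1 U 0 x; [lra..|].
rewrite (beam_u10 U) subr0 => eq.
have u2q : u2 q < 0.
  by move: u1x; rewrite eq subr0 pmulr_llt0.
have [||| p /andP[px pm]] := beam_mv1 U x m; [lra..|].
rewrite (beam_crit U) sub0r => ep.
have u2p : 0 < u2 p.
  by move: u1x; rewrite -oppr_gt0 ep pmulr_lgt0// subr_gt0.
have [||| s /andP[qs sp] es] := beam_mv2 U q p; [lra..|].
have u3s : 0 < u3 s.
  have : 0 < u3 s * (p - q) by rewrite -es; lra.
  by rewrite pmulr_lgt0//; lra.
have [||| y /andP[my y1]] := beam_mv1 U m 1; [lra..|].
rewrite (beam_crit U) (beam_u11 U) subrr.
move=> /esym/eqP; rewrite mulf_eq0 => /orP[]/eqP e; last lra.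
have [||| z /andP[pz zy]] := beam_mv2 U p y; [lra..|].
rewrite e sub0r => ez.
have : 0 < u3 z * (y - p).
  rewrite mulr_gt0//; last lra.
  by apply: lt_le_trans u3s _; apply: beam_u3_nd; lra.
lra.
Qed.

(* u'''' = lambda f(u) increases along with u on [0, m], so u''' is convex there
   and lies above its secants extended to the left. *)
Lemma beam_u3_0 d : 0 < d -> d <= 1 / 2 -> d <= m -> - (3 * B3 (d / 2)) <= u3 0.
Proof.
move=> d0 d1 dm; have /andP[m0 m1] := beam_m U.
have k1 : `|u3 (d / 2)| <= B3 (d / 2).
  by apply: beam_u3_interior; [lra|apply/andP; lra].
have k2 : `|u3 d| <= B3 (d / 2).
  by apply: beam_u3_interior; [lra|apply/andP; lra].
move: k1 k2; rewrite !ler_norml => /andP[k1 _] /andP[_ k2].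
(* Over two equal steps, [u4 p <= u4 q] gives [u3 0 >= 2 * u3 (d / 2) - u3 d], whence the factor
   3. *)
have [||| p /andP[p0 pd] ep] := beam_mv3 U 0 (d / 2); [lra..|].
have [||| q /andP[dq qd] eq] := beam_mv3 U (d / 2) d; [lra..|].
have u0pq : u0 p <= u0 q.
  rewrite -subr_ge0.
  have := @mean_value_ge _ _ _ p q 0 (beam_mv0 U).
  rewrite mul0r; apply; [lra..|] => z /andP[? ?].
  by apply: beam_u1_ge0; apply/andP; lra.
have : u4 p <= u4 q.
  rewrite !(beam_eq U); [|by apply/andP; lra..].
  apply: ler_wpM2l; first exact: ltW.
  have /andP[? _] : 0 <= u0 p < r.
    by apply: (beam_range U); apply/andP; lra.
  have /andP[_ ?] : 0 <= u0 q < r.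
    by apply: (beam_range U); apply/andP; lra.
  exact: f_nd.
have : 0 < d / 2 by lra.
rewrite (_ : d - d / 2 = d / 2) in eq; last lra.
rewrite subr0 in ep.
nra.
Qed.

Lemma beam_range_le x : 0 <= x <= 1 -> 0 <= u0 x <= u0 m /\ u0 m < r.
Proof.
move=> x01; have /andP[m0 m1] := beam_m U.
have /andP[u0x _] := beam_range U x01.
have /andP[_ um] : 0 <= u0 m < r by apply: (beam_range U); apply/andP; lra.
by rewrite u0x (beam_max U).
Qed.

Lemma beam_u4_le v L x : lambda <= L -> u0 m <= v -> v < r -> 0 < x < 1 ->
  u4 x <= L * f v.
Proof.
move=> lL uv vr x01; have /andP[x0 x1] := x01.
have [|/andP[u0x uxm] _] := @beam_range_le x; first by apply/andP; lra.
rewrite (beam_eq U)//; apply: ler_pM => //; first exact: ltW.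
- by apply/ltW/f_gt0; apply/andP; lra.
- by apply: f_nd => //; lra.
Qed.

Lemma beam_peak_gap C (k eta s : R) : (forall x, 0 <= x <= 1 -> `|u3 x| <= C) ->
    (forall v, r - eta < v -> v < r -> k <= (r - v) * f v) ->
    m <= 1 / 2 -> 0 < s -> s <= 1 / 2 -> s ^+ 2 * (1 + C1) < eta ->
    r - u0 m <= s ^+ 2 ->
  lambda * k <= 2 * C * (1 + C1) * s.
Proof.
move=> u3C fk m2 s0 s2 seta rm; have /andP[m0 m1] := beam_m U.
(* The mean value point [y] stands in for the integral of [u4] over a length [s]; [m + s] stays in
   [0, 1] because both terms are at most 1/2. *)
have [||| y /andP[my ys] ey] := beam_mv3 U m (m + s); [lra..|].
have y01 : 0 <= y <= 1 by apply/andP; lra.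
have [/andP[uy0 uym] umr] := beam_range_le y01.
have uy : r - u0 y <= s ^+ 2 * (1 + C1).
  have := @beam_drop y C1 beam_u2_ge => /(_ ltac:(apply/andP; lra)).
  have : C1 * (y - m) ^+ 2 <= C1 * s ^+ 2.
    by apply: (ler_wpM2l C1_ge0); rewrite ler_sqr ?nnegrE; lra.
  lra.
have fy : 0 < f (u0 y) by apply: f_gt0; apply/andP; lra.
have kf : k <= s ^+ 2 * (1 + C1) * f (u0 y).
  apply: le_trans (fk (u0 y) _ _) _; [lra|lra|].
  by apply: ler_wpM2r uy; exact: ltW.
have : u3 (m + s) - u3 m <= 2 * C.
  have : `|u3 (m + s)| <= C by apply: u3C; apply/andP; lra.
  have : `|u3 m| <= C by apply: u3C; apply/andP; lra.
  by rewrite !ler_norml => /andP[? ?] /andP[? ?]; lra.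
rewrite ey (beam_eq U); last by apply/andP; lra.
rewrite [m + s]addrC addrK => h.
have : lambda * k <= lambda * (s ^+ 2 * (1 + C1) * f (u0 y)).
  by apply: ler_wpM2l kf; exact: ltW.
move=> /le_trans; apply.
have -> : lambda * (s ^+ 2 * (1 + C1) * f (u0 y)) =
  lambda * f (u0 y) * s * ((1 + C1) * s) by ring.
rewrite -[leRHS]mulrA; apply: ler_wpM2r h.
by rewrite mulr_ge0//; have := C1_ge0; lra.
Qed.

(** Both functions have a zero, [u2] by Rolle between the clamped ends, and the interval has length
    1, so [C] passes down unchanged. *)
Lemma beam_u1_u2_bound C x : (forall y, 0 <= y <= 1 -> `|u3 y| <= C) ->
  0 <= x <= 1 -> `|u1 x| <= C /\ `|u2 x| <= C.
Proof.
move=> u3C.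
have [||| z /andP[z0 z1]] := beam_mv1 U 0 1; [lra..|].
rewrite (beam_u10 U) (beam_u11 U) !subr0 mulr1 => u2z.
have u2C y : 0 <= y <= 1 -> `|u2 y| <= C.
  move=> y01; rewrite -[u2 y]subr0 u2z.
  by apply: (mean_value_norm (beam_mv2 U)) => //; apply/andP; lra.
move=> x01; split; last exact: u2C.
rewrite -[u1 x]subr0 -(beam_u10 U).
by apply: (mean_value_norm (beam_mv1 U)) => //; apply/andP; lra.
Qed.

End Solution.

Lemma beam_u3_bound (L : R) : 0 < L -> exists C, 0 < C /\
  forall lambda u0 u1 u2 u3 u4 m, 0 < lambda -> lambda <= L ->
    beam r f lambda u0 u1 u2 u3 u4 m ->
    forall x, 0 <= x <= 1 -> `|u3 x| <= C.
Proof.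
move=> L0; have r0 := r_gt0; have C10 := C1_ge0.
have fr : 0 < f (r / 2) by apply: f_gt0; apply/andP; lra.
have Lf := mulr_gt0 L0 fr.
(* Chosen so that [C1 * d < r / 2]: a peak within [d] of an end is then lower than [r / 2]. *)
pose d := r / (4 * (C1 + r)).
have C1r : 0 < 4 * (C1 + r) by lra.
have d0 : 0 < d by rewrite divr_gt0.
have d4 : d <= 1 / 4 by rewrite ler_pdivrMr//; lra.
have dC : C1 * d < r / 2.
  have := mulr_ge0 C10 (ltW r0); have := mulr_gt0 r0 r0.
  by rewrite mulrA ltr_pdivrMr//; lra.
have b1 : 0 <= B3 (d / 2) by apply: B3_ge0; lra.
have b2 : 0 <= B3 (1 / 4) by apply: B3_ge0; lra.
exists (3 * B3 (d / 2) + B3 (1 / 4) + L * f (r / 2)); split; first lra.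
move=> l u0 u1 u2 u3 u4 m l0 lL U x x01.
have /andP[m0 m1] := beam_m U.
have /andP[x0 x1] := x01.
(* A low peak keeps [u4] below [L * f (r / 2)], so [u3] strays at most that far from its bounded
   value at 1/2. *)
have [um|um] := ltP (u0 m) (r / 2).
  have : `|u3 (1 / 2)| <= B3 (1 / 4).
    by apply: (beam_u3_interior l0 U); [lra|apply/andP; lra].
  have u4L y : 0 < y < 1 -> u4 y <= L * f (r / 2).
    by move=> ?; apply: (beam_u4_le l0 U) => //; lra.
  have h a b : 0 <= a -> a <= b -> b <= 1 -> 0 <= u3 b - u3 a <= L * f (r / 2).
    move=> a0 ab b1'; rewrite subr_ge0 (beam_u3_nd l0 U)//=.
    apply: (@le_trans _ _ (L * f (r / 2) * (b - a))).
      apply: (mean_value_le (beam_mv3 U) a0 ab b1') => y /andP[? ?].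
      by apply: u4L; apply/andP; lra.
    by rewrite ler_piMr//; lra.
  rewrite !ler_norml => /andP[? ?].
  have [xh|/ltW xh] := leP x (1 / 2).
    have /andP[? ?] := h x (1 / 2) x0 xh ltac:(lra); apply/andP; lra.
  have /andP[? ?] := h (1 / 2) x ltac:(lra) xh x1; apply/andP; lra.
have rU := beam_reflect U.
have dm : d <= m.
  have := beam_peak_right l0 rU; rewrite /= (_ : 1 - (1 - m) = m); last ring.
  move=> h; rewrite leNgt; apply/negP => /ltW md.
  by have := ler_wpM2l C10 md; lra.
have dm' : d <= 1 - m.
  have h := beam_peak_right l0 U; rewrite leNgt; apply/negP => /ltW md.
  by have := ler_wpM2l C10 md; lra.
(* Bounds at 0 and, through the reflection, at 1 enclose all values of the nondecreasing [u3]. *)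
have := beam_u3_0 l0 U d0 ltac:(lra) dm.
have := beam_u3_0 l0 rU d0 ltac:(lra) dm'.
rewrite /= subr0.
have := beam_u3_nd l0 U (lexx 0) x0 x1.
have := beam_u3_nd l0 U x0 x1 (lexx 1).
by rewrite ler_norml => ? ? ? ?; apply/andP; lra.
Qed.

Lemma beam_peak_bound (l1 L k eta : R) : 0 < l1 -> 0 < L -> 0 < k -> 0 < eta ->
    (forall v, r - eta < v -> v < r -> k <= (r - v) * f v) ->
  exists c, [/\ 0 < c, c < r &
    forall lambda u0 u1 u2 u3 u4 m, l1 <= lambda -> lambda <= L ->
      beam r f lambda u0 u1 u2 u3 u4 m -> u0 m <= c].
Proof.
move=> l10 L0 k0 eta0 fk; have r0 := r_gt0; have C10 := C1_ge0.
have [C [C0 u3C]] := beam_u3_bound L0.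
have K0 : 0 < 1 + C1 by lra.
have CK := mulr_gt0 C0 K0; have lk := mulr_gt0 l10 k0.
have CK4 : 0 < 4 * (C * (1 + C1)) by lra.
(* In order: room for the step from [m]; positivity of [r - s ^+ 2]; closeness to [r] within [eta],
   using [s ^+ 2 <= s / 2]; and [2 * C * (1 + C1) * s <= l1 * k / 2], which contradicts
   [beam_peak_gap]. *)
pose s := Num.min (Num.min (1 / 2) r)
  (Num.min (eta / (1 + C1)) (l1 * k / (4 * (C * (1 + C1))))).
have s0 : 0 < s by rewrite !lt_min r0 !divr_gt0.
have : s <= s by [].
rewrite {2}/s !le_min => /andP[/andP[s2 sr] /andP[]].
rewrite !ler_pdivlMr// => seta sl.
have ss : s ^+ 2 <= s / 2 by have := ler_wpM2l (ltW s0) s2; rewrite expr2; lra.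
have s20 : 0 < s ^+ 2 by rewrite exprn_gt0.
exists (r - s ^+ 2); split; [lra|lra|] => l u0 u1 u2 u3 u4 m l1l lL.
have l0 : 0 < l by lra.
wlog m2 : u0 u1 u2 u3 u4 m / m <= 1 / 2 => [hwlog|] U.
  have [m2|m2] := leP m (1 / 2); first exact: hwlog m2 U.
  have := hwlog _ _ _ _ _ _ _ (beam_reflect U).
  rewrite (_ : 1 - (1 - m) = m); last ring.
  by apply; lra.
rewrite leNgt; apply/negP => um.
have := beam_peak_gap l0 U (u3C _ _ _ _ _ _ _ l0 lL U) fk m2 s0 s2.
have -> : 2 * C * (1 + C1) * s = 2 * (s * (C * (1 + C1))) by ring.
have := ler_wpM2r (ltW K0) ss.
move=> ? /(_ ltac:(lra) ltac:(lra)).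
have : l1 * k <= l * k by apply: ler_wpM2r l1l; exact: ltW.
lra.
Qed.

End Apriori.
End Beam.

(** * From relative derivatives to the mean value setting *)

Section RelativeDerivative.
Context {R : realType}.
Implicit Types (D : set R) (g : R -> R) (a b x B : R).

Lemma derivable_in_continuous D g x : derivable_in D g x ->
  g @ within D (nbhs x) --> g x.
Proof.
move=> /cvg_ex[l gl].
have gx : g @ within D x^' --> g x.
  have idx : (fun y : R => y) @ within D x^' --> x.
    move=> A /= [e /= e0 eA]; exists e => //= y xy _ _; exact: eA.
  have h : (fun y => g x + diff_quot g x y * (y - x)) @ within D x^'
      --> g x + l * (x - x).
    apply: cvgD; first exact: cvg_cst.
    by apply: cvgM gl _; apply: cvgB idx _; exact: cvg_cst.
  rewrite subrr mulr0 addr0 in h; apply: cvg_trans h; apply: near_eq_cvg.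
  exists 1 => //= y _ yx _; rewrite /diff_quot divfK; first by rewrite addrC subrK.
  by rewrite subr_eq0.
(* The limit [gx] is along a punctured neighbourhood; the point [x] itself is added by hand. *)
move=> A Ax; have /= [e /= e0 eA] := gx _ Ax.
exists e => //= y xy Dy; have [->|yx] := eqVneq y x; first exact: nbhs_singleton.
exact: eA.
Qed.

Lemma Ck_on_continuous D k g i : Ck_on D k g -> (i <= k)%N ->
  {within D, continuous (derive_in_n D i g)}.
Proof.
move=> [dg cg]; rewrite leq_eqVlt => /orP[/eqP->//|ik].
by apply/subspace_continuousP => x Dx; apply/derivable_in_continuous/dg.
Qed.

Lemma nbhs_oo_subset D a b x : `[a, b] `<=` D -> x \in `]a, b[ -> nbhs x D.
Proof.
move=> abD xab; apply: filterS (near_in_itvoo xab) => y yab.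
by apply: abD; exact: subset_itv_oo_cc yab.
Qed.

(** Inside the interval the relative derivative is the ordinary one; at the ends only relative
    continuity enters. *)
Lemma derive_in_MVT D g a b : a < b -> `[a, b] `<=` D ->
    (forall x, D x -> derivable_in D g x) ->
  exists2 c, a < c < b & g b - g a = derive_in D g c * (b - a).
Proof.
move=> ab abD dg.
have [x xab||c cab e] := @MVT R g (derive_in D g) a b ab.
- have xD := nbhs_oo_subset abD xab.
  apply: DeriveDef; first exact/(derivable_inE g xD)/dg/(nbhs_singleton xD).
  by rewrite (derive_inE g xD) derive1E.
- apply: (continuous_subspaceW abD); apply/subspace_continuousP => x Dx.
  exact/derivable_in_continuous/dg.
- by exists c => //; move: cab; rewrite in_itv.
Qed.

Lemma Ck_on_mean_value k (g : R -> R) i : Ck_on `[0, 1] k g -> (i < k)%N ->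
  mean_value (derive_in_n `[0, 1] i g) (derive_in_n `[0, 1] i.+1 g).
Proof.
move=> [dg _] ik a b a0 ab b1; apply: derive_in_MVT => // [x /=|x xD].
  by rewrite !in_itv/= => /andP[? ?]; apply/andP; split; lra.
exact: dg.
Qed.

Lemma Ck_on_nondecreasing (r : R) (f : R -> R) : Ck_on `[0, r[ 1 f ->
    (forall v, 0 < v < r -> 0 < derive_in `[0, r[ f v) ->
  forall v w, 0 <= v -> v <= w -> w < r -> f v <= f w.
Proof.
move=> [df _] df0 v w v0; rewrite le_eqVlt => /orP[/eqP->//|vw] wr.
have [||x xD|c /andP[vc cw] e] := @derive_in_MVT `[0, r[ f v w.
- by [].
- by move=> x /=; rewrite !in_itv/= => /andP[? ?]; apply/andP; split; lra.
- exact: (df 0%N).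
- rewrite -subr_ge0 e mulr_ge0//; last lra.
  by apply/ltW/df0; apply/andP; split; lra.
Qed.

Lemma limf_einf_left_gt0 (r : R) (h : R -> R) :
    (0 < limf_einf (fun v => (h v)%:E) r^'-)%E ->
  exists k eta : R, [/\ 0 < k, 0 < eta &
    forall v, r - eta < v -> v < r -> k <= h v].
Proof.
rewrite limf_einfE => /ereal_sup_gt[_ [V Vr <-] V0].
(* The infimum is an extended real; were it infinite, 1 would serve as [k]. *)
have [k k0 kV] : exists2 k : R, 0 < k &
    (k%:E <= ereal_inf ((fun v => (h v)%:E) @` V))%E.
  case: (ereal_inf _) V0 => [s||//].
    by rewrite lte_fin => s0; exists s.
  by move=> _; exists 1 => //; rewrite leey.
move: Vr => [e /= e0 eV]; exists k, e; split=> // v rv vr.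
rewrite -lee_fin; apply: le_trans kV _; apply: ereal_inf_lbound.
exists v => //; apply: eV => //=; rewrite ger0_norm; lra.
Qed.

Lemma C_norm_le D g B : D !=set0 -> (forall x, D x -> `|g x| <= B) ->
  C_norm D g <= B.
Proof.
move=> [y Dy] gB; apply: ge_sup; first by exists `|g y|; exists y.
by move=> _ [x Dx <-]; exact: gB.
Qed.

Lemma C_norm_itv_le g B : (forall x, 0 <= x <= 1 -> `|g x| <= B) ->
  C_norm `[0, 1] g <= B.
Proof.
move=> gB; apply: C_norm_le => [|x].
  by exists 0; rewrite /= in_itv /= lexx ler01.
by rewrite /= in_itv; exact: gB.
Qed.

(** Needed for the fourth derivative, which the equation controls on the open interval only. *)
Lemma within_continuous_norm_le g B : {within `[0, 1], continuous g} ->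
  (forall x, 0 < x < 1 -> `|g x| <= B) -> forall x, 0 <= x <= 1 -> `|g x| <= B.
Proof.
move=> /(continuous_within_itvP _ ltr01)[_ g0 g1] gB x /andP[].
rewrite le_eqVlt => /orP[/eqP<- _|x0].
  apply: (cvgr_to_le (cvg_norm g0)); near=> y; apply: gB.
  by apply/andP; split; near: y; [exact: nbhs_right_gt|exact: nbhs_right_lt].
rewrite le_eqVlt => /orP[/eqP->|x1]; last by apply: gB; rewrite x0.
apply: (cvgr_to_le (cvg_norm g1)); near=> y; apply: gB.
by apply/andP; split; near: y; [exact: nbhs_left_gt|exact: nbhs_left_lt].
Unshelve. all: by end_near. Qed.

(** The maximum of [u] is positive because [u] is nonnegative and not identically zero, so it is
    attained away from the clamped ends and is a critical point. *)
Lemma positive_solution_beam (r : R) (f : R -> R) lambda u :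
  positive_solution r f lambda u -> exists m,
  beam r f lambda u (derive_in_n `[0, 1] 1 u) (derive_in_n `[0, 1] 2 u)
    (derive_in_n `[0, 1] 3 u) (derive_in_n `[0, 1] 4 u) m.
Proof.
move=> [l0 uC4 [ur [y y01 uy]] ueq [u0 u1 du0 du1]].
have [m m01 um] := EVT_max ler01 (@Ck_on_continuous _ _ _ 0 uC4 isT).
rewrite /= in um.
have um0 : 0 < u m.
  have y01' : y \in `[0, 1] by exact: subset_itv_oo_cc y01.
  apply: lt_le_trans (um y y01'); rewrite lt_neqAle eq_sym uy /=.
  by have /andP[] := ur y y01'.
have m01' : m \in `]0, 1[.
  move: m01; rewrite !in_itv/= => /andP[m0 m1]; rewrite !lt_neqAle m0 m1 !andbT.
  apply/andP; split; apply/eqP => e; move: um0.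
    by rewrite -e u0 ltxx.
  by rewrite e u1 ltxx.
have int x : x \in `]0, 1[ -> nbhs x (`[0, 1]%classic : set R).
  by move=> ?; apply: (@nbhs_oo_subset _ 0 1).
exists m; split.
- exact: (@Ck_on_mean_value _ _ 0 uC4).
- exact: (@Ck_on_mean_value _ _ 1 uC4).
- exact: (@Ck_on_mean_value _ _ 2 uC4).
- exact: (@Ck_on_mean_value _ _ 3 uC4).
- by move=> x x01; apply: ueq; rewrite in_itv.
- by move=> x x01; apply: ur; rewrite in_itv.
- by [].
- by [].
- by [].
- by [].
- by move: m01'; rewrite in_itv.
- rewrite /derive_in_n /= (derive_inE u (int m m01')) derive1E.
  have [|t t01||t t01|_ ->//] := @derive1_at_max R u 0 1 m.
  + exact: ler01.
  + apply/(derivable_inE u (int t t01)).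
    exact: (uC4.1 0%N t isT (nbhs_singleton (int t t01))).
  + exact: m01'.
  + by apply: um; exact: subset_itv_oo_cc t01.
- by move=> x x01; apply: um; rewrite in_itv.
Qed.

End RelativeDerivative.

(** * From pointwise bounds to the norms *)

Theorem lemma2p1 (R : realType) (r : R) (f : R -> R)
  (r_gt0 : 0 < r)
  (f_C1 : Ck_on `[0, r[ 1 f)
  (f_gt0 : forall v, 0 <= v < r -> 0 < f v)
  (df_gt0 : forall v, 0 < v < r -> 0 < derive_in `[0, r[ f v)
  (f_liminf : (0 < limf_einf (fun v => ((r - v) * f v)%:E) r^'-)%E) :
  forall I : set R, is_interval I -> bounded_set I -> I `<=` `[0, +oo[ ->
    (exists C : R, 0 < C /\
      forall (lambda : R) (u : R -> R), I lambda ->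
        positive_solution r f lambda u -> Ck_norm `[0, 1] 3 u <= C) /\
    (compact I -> I `<=` `]0, +oo[ ->
      exists c C1 : R, [/\ 0 < c, c < r, 0 < C1 &
        forall (lambda : R) (u : R -> R), I lambda ->
          positive_solution r f lambda u ->
          C_norm `[0, 1] u <= c /\ Ck_norm `[0, 1] 4 u <= C1]).
Proof.
move=> I _ bI _.
have f_nd := Ck_on_nondecreasing f_C1 df_gt0.
have [L L0 IL] : exists2 L : R, 0 < L & forall lambda, I lambda -> lambda <= L.
  (* Boundedness provides every bound strictly above [M]; this one is also positive. *)
  have [M [_ MI]] := bI; exists (`|M| + 1); first by have := normr_ge0 M; lra.
  move=> l Il; apply: le_trans (ler_norm l) _.
  by apply: MI Il; have := ler_norm M; lra.
have [C [C0 u3C]] := beam_u3_bound r_gt0 f_gt0 f_nd L0.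
have Ck3 lambda u : I lambda -> positive_solution r f lambda u ->
    Ck_norm `[0, 1] 3 u <= r + 3 * C.
  move=> Il ul; have [l0 _ _ _ _] := ul; have [m U] := positive_solution_beam ul.
  have u3 := u3C _ _ _ _ _ _ _ l0 (IL _ Il) U.
  have u12 x (x01 : 0 <= x <= 1) := beam_u1_u2_bound U u3 x01.
  have n0 : C_norm `[0, 1] u <= r.
    apply: C_norm_itv_le => x /(beam_range U)/andP[? ?].
    by rewrite ger0_norm// ltW.
  have n1 : C_norm `[0, 1] (derive_in_n `[0, 1] 1 u) <= C.
    by apply: C_norm_itv_le => x x01; case: (u12 x x01).
  have n2 : C_norm `[0, 1] (derive_in_n `[0, 1] 2 u) <= C.
    by apply: C_norm_itv_le => x x01; case: (u12 x x01).
  have n3 := C_norm_itv_le u3.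
  by rewrite /Ck_norm !big_ord_recr big_ord0 /=; lra.
split; first by exists (r + 3 * C); split; [lra|exact: Ck3].
move=> cI Ipos.
(* A nonempty compact [I] contains its least element, which is therefore positive; for empty [I] any
   positive value will do. *)
have [l1 l10 Il1] : exists2 l1 : R, 0 < l1 & forall lambda, I lambda -> l1 <= lambda.
  have [I0|/set0P I0] := eqVneq I set0.
    by exists 1 => // l; rewrite I0.
  have cid : {within I, continuous (fun x : R => x)}.
    by apply: continuous_subspaceT => x; exact: cvg_id.
  have [l1 /set_mem Il1 Imin] := compact_EVT_min I0 cI cid.
  exists l1; first by have := Ipos _ Il1; rewrite /= in_itv/= andbT.
  by move=> l /mem_set/Imin.
have [k [eta [k0 eta0 fk]]] := limf_einf_left_gt0 f_liminf.
have [c [c0 cr umc]] := beam_peak_bound r_gt0 f_gt0 f_nd l10 L0 k0 eta0 fk.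
have Lf : 0 < L * f c by rewrite mulr_gt0// f_gt0// ltW.
exists c, (r + 3 * C + L * f c); split=> //; first lra.
move=> lambda u Il ul; have [l0 uC4 _ _ _] := ul.
have [m U] := positive_solution_beam ul; have lL := IL _ Il.
have um := umc _ _ _ _ _ _ _ (Il1 _ Il) lL U.
split.
  apply: C_norm_itv_le => x x01; have [/andP[? ?] _] := beam_range_le U x01.
  by rewrite ger0_norm//; lra.
have n4 : C_norm `[0, 1] (derive_in_n `[0, 1] 4 u) <= L * f c.
  apply/C_norm_itv_le/within_continuous_norm_le; first exact: Ck_on_continuous uC4 _.
  move=> x x01; rewrite ger0_norm; last exact/ltW/(beam_u4_gt0 f_gt0 l0 U).
  exact: (beam_u4_le f_gt0 f_nd l0 U).
have := Ck3 _ _ Il ul; rewrite /Ck_norm [X in _ -> X <= _]big_ord_recr /=; lra.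
Qed.
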